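(* Let $n\in\mathbb{N}$, let $I$ be an ideal of $\mathcal{IP}_n$ and let $k\in\mathbb{N}$ with $k\leq n$. Then: (1) for all $b\in\mathcal{IP}_n$, $I_k=\mathcal{IP}_n\,b\,\mathcal{IP}_n$ if and only if $\mathrm{rank}(b)=k$; (2) $I=I_m$ for some $m\in\mathbb{N}$, $m\leq n$; (3) $I=\mathcal{IP}_n\,a\,\mathcal{IP}_n$ for some $a\in\mathcal{IP}_n$.
   Context: Let $X$ be an arbitrary set and let $X'=\{x':x\in X\}$ be a disjoint copy of $X$, with $x\mapsto x'$ a fixed bijection $X\to X'$; the inverse bijection is also denoted by $'$. Let $\mathcal{CS}_X$ be the set of all partitions of $X\cup X'$ into nonempty blocks. For $a\in\mathcal{CS}_X$ write $x\equiv_a y$ if $x,y\in X\cup X'$ lie in the same block of $a$. The product $ab$ of $a,b\in\mathcal{CS}_X$ is the partition corresponding to the equivalence relation $\equiv$ on $X\cup X'$ defined, for $x,y\in X$, by: (i) $x\equiv y$ iff $x\equiv_a y$ or there are $s\ge 1$ and $c_1,\dots,c_{2s}\in X$ with $x\equiv_a c_1'$, $c_1\equiv_b c_2$, $c_2'\equiv_a c_3'$, $\dots$, $c_{2s-1}\equiv_b c_{2s}$, $c_{2s}'\equiv_a y$; (ii) $x'\equiv y'$ iff $x'\equiv_b y'$ or there are $s\ge 1$ and $c_1,\dots,c_{2s}\in X$ with $x'\equiv_b c_1$, $c_1'\equiv_a c_2'$, $c_2\equiv_b c_3$, $\dots$, $c_{2s-1}'\equiv_a c_{2s}'$, $c_{2s}\equiv_b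 y'$; (iii) $x\equiv y'$ iff $y'\equiv x$ iff there are $s\ge 1$ and $c_1,\dots,c_{2s-1}\in X$ with $x\equiv_a c_1'$, $c_1\equiv_b c_2$, $c_2'\equiv_a c_3'$, $\dots$, $c_{2s-2}'\equiv_a c_{2s-1}'$, $c_{2s-1}\equiv_b y'$. With this product $\mathcal{CS}_X$ is a semigroup, and $\mathcal{IP}_X$ is the subsemigroup of all $a\in\mathcal{CS}_X$ each of whose blocks meets both $X$ and $X'$. For $X=\{1,\dots,n\}$ write $\mathcal{IP}_n$. The rank of $a\in\mathcal{IP}_n$ is the number of its blocks, and $I_k=\{a\in\mathcal{IP}_n:\mathrm{rank}(a)\le k\}$. ''Ideal'' means (nonempty) two-sided semigroup ideal. $\mathbb{N}=\{1,2,\dots\}$. *)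

(* Defs.v *)
From mathcomp Require Import all_boot.
From mathcomp Require Import boolp.

Set Implicit Arguments.
Unset Strict Implicit.
Unset Printing Implicit Defensive.

Section PartitionSemigroup.

Variable X : finType.

(* [X + X] is the union of [X] and its disjoint copy [X']: [inl x] is x, and
   [inr x] is x'. *)
Definition CS : {set {set {set X + X}}} := [set a | partition a [set: X + X]].

Definition IP : {set {set {set X + X}}} :=
  [set a in CS | [forall B in a, [exists x, inl x \in B] && [exists x, inr x \in B]]].

Definition same_block (a : {set {set X + X}}) (u v : X + X) : bool :=
  v \in pblock a u.

(* The chains c_1, c_2, ... are functions on [nat] of which only the relevant
   values, indexed from 1, are constrained. *)
Definition mul_rel_ll (a b : {set {set X + X}}) (x y : X) : Prop :=
  same_block a (inl x) (inl y) \/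
  exists (s : nat) (c : nat -> X),
    [/\ 1 <= s,
        same_block a (inl x) (inr (c 1)),
        forall i, 1 <= i <= s -> same_block b (inl (c (2 * i - 1))) (inl (c (2 * i))),
        forall i, 1 <= i < s -> same_block a (inr (c (2 * i))) (inr (c (2 * i + 1)))
      & same_block a (inr (c (2 * s))) (inl y)].

Definition mul_rel_rr (a b : {set {set X + X}}) (x y : X) : Prop :=
  same_block b (inr x) (inr y) \/
  exists (s : nat) (c : nat -> X),
    [/\ 1 <= s,
        same_block b (inr x) (inl (c 1)),
        forall i, 1 <= i <= s -> same_block a (inr (c (2 * i - 1))) (inr (c (2 * i))),
        forall i, 1 <= i < s -> same_block b (inl (c (2 * i))) (inl (c (2 * i + 1)))
      & same_block b (inl (c (2 * s))) (inr y)].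

Definition mul_rel_lr (a b : {set {set X + X}}) (x y : X) : Prop :=
  exists (s : nat) (c : nat -> X),
    [/\ 1 <= s,
        same_block a (inl x) (inr (c 1)),
        forall i, 1 <= i < s -> same_block b (inl (c (2 * i - 1))) (inl (c (2 * i))),
        forall i, 1 <= i < s -> same_block a (inr (c (2 * i))) (inr (c (2 * i + 1)))
      & same_block b (inl (c (2 * s - 1))) (inr y)].

Definition mul_rel (a b : {set {set X + X}}) (u v : X + X) : Prop :=
  match u, v with
  | inl x, inl y => mul_rel_ll a b x y
  | inr x, inr y => mul_rel_rr a b x y
  | inl x, inr y => mul_rel_lr a b x y
  | inr y, inl x => mul_rel_lr a b x y
  end.

Definition mul (a b : {set {set X + X}}) : {set {set X + X}} :=
  equivalence_partition (fun u v => `[< mul_rel a b u v >]) [set: X + X].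

Definition rank (a : {set {set X + X}}) : nat := #|a|.

Definition rank_le (k : nat) : {set {set {set X + X}}} :=
  [set a in IP | rank a <= k].

Definition ideal (I : {set {set {set X + X}}}) : Prop :=
  [/\ I != set0, I \subset IP &
      forall a c, a \in I -> c \in IP -> mul a c \in I /\ mul c a \in I].

Definition IP_mul_IP (b : {set {set X + X}}) : {set {set {set X + X}}} :=
  [set mul (mul c b) d | c in IP, d in IP].

End PartitionSemigroup.

Arguments IP X : clear implicits.
Arguments CS X : clear implicits.
Arguments rank_le X k : clear implicits.

(* Main.v *)
From mathcomp Require Import all_boot boolp zify.
Require Import Defs.

(* An element of IP_X is a pair of surjections from X and X' onto its set of
   blocks, and the blocks of a product are given by the pushout of the two block
   maps along the middle copy of X. Both legs of this pushout are surjective, so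
   rank (ab) <= min (rank a, rank b). Conversely, if rank c <= rank b then
   c = d b e for some d and e in IP_X: choose a surjection s from the blocks of b
   onto those of c and push it out. Hence IP_X b IP_X = I_(rank b), and an ideal
   is generated by any of its elements of maximal rank. *)

Set Implicit Arguments.
Unset Strict Implicit.
Unset Printing Implicit Defensive.

(** * Alternating chains and cardinalities of images *)

Lemma alternating_eq (T : Type) (f : nat -> T) (s : nat) :
  1 <= s -> (forall i, 1 <= i < s -> f (2 * i - 1) = f (2 * i)) ->
  (forall i, 1 <= i < s -> f (2 * i) = f (2 * i + 1)) -> f (2 * s - 1) = f 1.
Proof.
case: s => // s _; elim: s => [|s IHs] f_odd f_even; first by [].
have -> : 2 * s.+2 - 1 = 2 * s.+1 + 1 by lia.
rewrite -f_even -?f_odd ?leqnn //.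
by apply: IHs => i i_s; [apply: f_odd | apply: f_even]; lia.
Qed.

(** By reflexivity, each edge of the path becomes a [B]-step followed by an [A]-step, one of them
    trivial. *)
Lemma alternating_chain (X : finType) (A B : rel X) x y :
  reflexive A -> reflexive B -> connect [rel u v | A u v || B u v] x y ->
  exists s (c : nat -> X),
    [/\ 1 <= s, c 1 = x, c (2 * s + 1) = y,
        forall i, 1 <= i <= s -> B (c (2 * i - 1)) (c (2 * i))
      & forall i, 1 <= i <= s -> A (c (2 * i)) (c (2 * i + 1))].
Proof.
move=> Axx Bxx /connectP[p]; elim/last_ind: p y => [|p z IHp] y /=.
  (* The empty path gives a constant chain with [s = 1], because [s = 0] is excluded. *)
  by move=> _ ->; exists 1, (fun=> x).
rewrite rcons_path last_rcons => /andP[/IHp/(_ erefl)[s [c]]].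
set w := last x p => -[s_gt0 c1 cw cB cA] AB_wz ->.
have [m Bwm Amz] : exists2 m, B w m & A m z.
  by case/orP: AB_wz => ?; [exists w | exists z].
(* The old chain ends at index [2 * s + 1] in [w]; it is extended by [m] at [2 * s + 2] and [z] at
   [2 * s + 3]. *)
exists s.+1, (fun i => if i <= 2 * s + 1 then c i
                       else if i == 2 * s.+1 then m else z).
split=> //= [||i i_s|i i_s].
- by rewrite ifT //; lia.
- by do 2![rewrite ifF; last lia].
- have [le_is|lt_si] := leqP i s; first by do 2![rewrite ifT; last lia]; apply: cB; lia.
  have -> : i = s.+1 by lia.
  rewrite ifT; last lia.
  have -> : 2 * s.+1 - 1 = 2 * s + 1 by lia.
  by rewrite cw ifF ?eqxx //; lia.
- have [le_is|lt_si] := leqP i s; first by do 2![rewrite ifT; last lia]; apply: cA; lia.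
  have -> : i = s.+1 by lia.
  rewrite ifF; last lia.
  by rewrite eqxx; do 2![rewrite ifF; last lia].
Qed.

(** The map [k] factors through [h] by way of [g], which chooses preimages; [k x0] is a default off
    the image of [h]. *)
Lemma leq_card_imset_factor (S T U : finType) (h : S -> T) (k : S -> U) :
  (forall x y, h x = h y -> k x = k y) ->
  #|k @: [set: S]| <= #|h @: [set: S]|.
Proof.
move=> hk; have [S0|[x0 _]] := set_0Vmem [set: S]; first by rewrite S0 !imset0 cards0.
pose g t := if [pick x | h x == t] is Some x then k x else k x0.
suff -> : k @: [set: S] = g @: (h @: [set: S]) by apply: leq_imset_card.
rewrite -imset_comp; apply: eq_imset => x /=; rewrite /g.
by case: pickP => [y /eqP/hk //|/(_ x)]; rewrite eqxx.
Qed.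

Lemma surjection_of_leq_card (T : finType) (A B : {set T}) :
  B != set0 -> #|B| <= #|A| -> exists s : T -> T, s @: A = B.
Proof.
move=> /set0Pn[y0 By0]; rewrite !cardE => leBA.
(* The i-th element of [A] goes to the i-th element of [B], and surplus ones to the default [y0],
   itself in [B]. *)
exists (fun x => nth y0 (enum B) (index x (enum A))).
apply/setP=> y; apply/imsetP/idP => [[x _ ->]|By].
  have [lt_xB|le_Bx] := ltnP (index x (enum A)) (size (enum B)).
    by rewrite -mem_enum mem_nth.
  by rewrite nth_default.
have lt_y : index y (enum B) < size (enum B) by rewrite index_mem mem_enum.
have lt_yA := leq_trans lt_y leBA.
exists (nth y0 (enum A) (index y (enum B))); first by rewrite -mem_enum mem_nth.
by rewrite index_uniq ?enum_uniq // nth_index // mem_enum.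
Qed.

(** * Elements of [IP X] as kernels of maps *)

Section Blocks.

Variable X : finType.
Implicit Types (a b c d : {set {set X + X}}) (x y : X) (u v : X + X).

Lemma IP_partition a : a \in IP X -> partition a setT.
Proof. by rewrite !inE => /andP[]. Qed.

Lemma same_blockE a u v :
  a \in IP X -> same_block a u v = (pblock a u == pblock a v).
Proof.
move=> /IP_partition aP; have [/eqP cov_a tI_a _] := and3P aP.
by rewrite /same_block eq_pblock // cov_a.
Qed.

Lemma IP_preim_pblock a : a \in IP X -> preim_partition (pblock a) setT = a.
Proof. by move=> /IP_partition /preim_partition_pblock. Qed.

Lemma pblock_in_IP a u : a \in IP X -> pblock a u \in a.
Proof. by move=> /IP_partition aP; rewrite pblock_mem // (cover_partition aP). Qed.

Lemma IP_block_meets a (B : {set X + X}) : a \in IP X -> B \in a ->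
  (exists x, pblock a (inl x) = B) /\ (exists x, pblock a (inr x) = B).
Proof.
rewrite !inE => /andP[/and3P[_ tI_a _] /forall_inP meets] aB.
have /andP[/existsP[x Bx] /existsP[y By]] := meets B aB.
by split; [exists x | exists y]; apply: def_pblock.
Qed.

Lemma same_block_preim (T : eqType) (h : X + X -> T) u v :
  same_block (preim_partition h setT) u v = (h u == h v).
Proof.
rewrite /same_block pblock_equivalence_partition ?inE //.
by move=> x y z _ _ _; split=> // /eqP->.
Qed.

Lemma preim_partition_IP (T : eqType) (h : X + X -> T) :
  (forall u, (exists x, h (inl x) = h u) /\ (exists x, h (inr x) = h u)) ->
  preim_partition h setT \in IP X.
Proof.
move=> h_meets; rewrite !inE preim_partitionP /=.
apply/forall_inP => _ /imsetP[u _ ->]; have [[x hx] [y hy]] := h_meets u.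
by apply/andP; split; apply/existsP; [exists x | exists y]; rewrite !inE ?hx ?hy eqxx.
Qed.

Lemma rank_preim (T : finType) (h : X + X -> T) :
  rank (preim_partition h setT) = #|h @: [set: X + X]|.
Proof.
rewrite /rank; apply/eqP; rewrite eqn_leq; apply/andP; split.
  by apply: leq_card_imset_factor => u v huv; apply/setP=> w; rewrite !inE huv.
by apply: leq_card_imset_factor => u v /setP/(_ v); rewrite !inE eqxx => /eqP.
Qed.

(** * Products as pushouts, and the rank inequality *)

Definition glue (T : Type) (f g : X + X -> T) u :=
  match u with inl _ => f u | inr _ => g u end.

Section Cocone.

Variables (a b : {set {set X + X}}) (T : Type) (f g : X + X -> T).
Hypotheses (fP : forall u v, same_block a u v -> f u = f v)
           (gP : forall u v, same_block b u v -> g u = g v)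
           (fg : forall x, f (inr x) = g (inl x)).

(** Since [f] and [g] agree on the middle copy, they take a single value along any chain. This is
    the easy half of the pushout property. *)
Lemma mul_rel_glue u v : mul_rel a b u v -> glue f g u = glue f g v.
Proof.
have lr x y : mul_rel_lr a b x y -> f (inl x) = g (inr y).
  case=> s [c [s_gt0 /fP-> cb ca /gP<-]]; rewrite !fg.
  symmetry; apply: (alternating_eq (f := fun i => g (inl (c i)))) => // i i_s.
    by apply/gP/cb.
  by rewrite -!fg; apply/fP/ca.
case: u v => [x|x] [y|y] /=; [|exact: lr|by move/lr|].
(* A one-sided chain ends at index [2 * s]; its last [b]-step is used first, to come down to the
   index [2 * s - 1] of [alternating_eq]. *)
- case=> [/fP //|[s [c [s_gt0 /fP-> cb ca /fP<-]]]]; rewrite !fg -(gP (cb s _)) ?s_gt0 ?leqnn //.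
  symmetry; apply: (alternating_eq (f := fun i => g (inl (c i)))) => // i i_s.
    by apply/gP/cb; lia.
  by rewrite -!fg; apply/fP/ca.
- case=> [/gP //|[s [c [s_gt0 /gP-> ca cb /gP<-]]]]; rewrite -!fg -(fP (ca s _)) ?s_gt0 ?leqnn //.
  symmetry; apply: (alternating_eq (f := fun i => f (inr (c i)))) => // i i_s.
    by apply/fP/ca; lia.
  by rewrite !fg; apply/gP/cb.
Qed.

End Cocone.

Lemma mul_preim (T : eqType) (h : X + X -> T) a b :
  (forall u v, mul_rel a b u v <-> h u = h v) ->
  mul a b = preim_partition h setT.
Proof.
move=> ab_h; rewrite /mul /preim_partition; congr equivalence_partition.
apply/funext => u; apply/funext => v.
by apply/asboolP/eqP => /ab_h.
Qed.

(* The pushout of the two block maps along the middle copy of [X] is realised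
   by roots of connected components in [X]. *)
Lemma mul_IP_pushout a b : a \in IP X -> b \in IP X ->
  exists f g : X + X -> X,
    [/\ forall u v, same_block a u v -> f u = f v,
        forall u v, same_block b u v -> g u = g v,
        forall x, f (inr x) = g (inl x)
      & mul a b = preim_partition (glue f g) setT].
Proof.
move=> aP bP.
pose A := [rel x y : X | same_block a (inr x) (inr y)].
pose B := [rel x y : X | same_block b (inl x) (inl y)].
pose e := [rel x y | A x y || B x y].
have e_sym : connect_sym e.
  by apply: sym_connect_sym => x y; rewrite /= !same_blockE //; congr orb; rewrite eq_sym.
have Axx : reflexive A by move=> x /=; rewrite same_blockE.
have Bxx : reflexive B by move=> x /=; rewrite same_blockE.
(* Any point moves to the middle copy inside its block: [t u] through [a], [r u] through [b]. The
   root of the component reached there is its label. *)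
have [t tP] := choice (fun u => (IP_block_meets aP (pblock_in_IP u aP)).2).
have [r rP] := choice (fun u => (IP_block_meets bP (pblock_in_IP u bP)).1).
pose f u := root e (t u); pose g u := root e (r u).
have fP u v : same_block a u v -> f u = f v.
  move=> auv; apply/(rootP e_sym)/connect1/orP; left.
  by rewrite /= same_blockE // !tP -same_blockE.
have gP u v : same_block b u v -> g u = g v.
  move=> buv; apply/(rootP e_sym)/connect1/orP; right.
  by rewrite /= same_blockE // !rP -same_blockE.
have fg x : f (inr x) = g (inl x).
  apply: (@etrans _ _ (root e x)); first last.
    by apply/(rootP e_sym)/connect1/orP; right; rewrite /= same_blockE // rP.
  by apply/(rootP e_sym)/connect1/orP; left; rewrite /= same_blockE // tP.
exists f, g; split=> //; apply: mul_preim => u v.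
split; first exact: mul_rel_glue.
have lr x y : f (inl x) = g (inr y) -> mul_rel_lr a b x y.
  move=> /(rootP e_sym)/(alternating_chain Axx Bxx)[s [c [s_gt0 c1 cs cB cA]]].
  (* The chain from [t (inl x)] to [r (inr y)] has [2 * s + 1 = 2 * s.+1 - 1] points; the outer
     steps are those defining [t] and [r]. *)
  exists s.+1, c; split=> //; first by rewrite c1 same_blockE // tP.
  have -> : 2 * s.+1 - 1 = 2 * s + 1 by lia.
  by rewrite cs same_blockE // rP.
case: u v => [x|x] [y|y] /=; [|exact: lr|by move/esym/lr|].
- move=> /(rootP e_sym)/(alternating_chain Axx Bxx)[s [c [s_gt0 c1 cs cB cA]]].
  right; exists s, c; split=> // [|i i_s|].
  - by rewrite c1 same_blockE // tP.
  - by apply: cA; lia.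
  (* The last [A]-step reaches [t (inl y)], in the [a]-block of [inl y], so the chain can stop at
     index [2 * s]. *)
  have /= := cA s; rewrite s_gt0 leqnn => /(_ isT).
  by rewrite cs !same_blockE // => /eqP->; rewrite tP.
(* Between points of the lower copy the chain must begin with an [a]-step, so [A] and [B] exchange
   roles. *)
- have ->: root e (r (inr x)) = root e (r (inr y)) <->
    connect [rel x y | B x y || A x y] (r (inr x)) (r (inr y)).
    have -> : connect [rel x y | B x y || A x y] =2 connect e.
      by apply: eq_connect => ? ?; rewrite /= orbC.
    by split=> /(rootP e_sym).
  move=> /(alternating_chain Bxx Axx)[s [c [s_gt0 c1 cs cA cB]]].
  right; exists s, c; split=> // [|i i_s|].
  - by rewrite c1 same_blockE // rP.
  - by apply: cB; lia.
  have /= := cB s; rewrite s_gt0 leqnn => /(_ isT).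
  by rewrite cs !same_blockE // => /eqP->; rewrite rP.
Qed.

Lemma mul_IP a b : a \in IP X -> b \in IP X -> mul a b \in IP X.
Proof.
move=> aP bP; have [f [g [fP gP fg ->]]] := mul_IP_pushout aP bP.
have a_meets u := IP_block_meets aP (pblock_in_IP u aP).
have b_meets u := IP_block_meets bP (pblock_in_IP u bP).
have fE u v : pblock a u = pblock a v -> f u = f v.
  by move=> auv; apply: fP; rewrite same_blockE // auv.
have gE u v : pblock b u = pblock b v -> g u = g v.
  by move=> buv; apply: gP; rewrite same_blockE // buv.
apply: preim_partition_IP => -[x|x] /=; split; try by exists x.
(* From [inl x], cross its [a]-block to [inr y], then the [b]-block of [inl y] to [inr z]; the other
   case is the mirror image. *)
- have [y ay] := (a_meets (inl x)).2; have [z bz] := (b_meets (inl y)).2.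
  by exists z; rewrite -(fE _ _ ay) fg; apply: gE.
- have [y by_] := (b_meets (inr x)).1; have [z az] := (a_meets (inr y)).1.
  by exists z; rewrite -(gE _ _ by_) -fg; apply: fE.
Qed.

Lemma rank_imset_pblock a :
  a \in IP X -> rank a = #|pblock a @: [set: X + X]|.
Proof. by move=> aP; rewrite -{1}(IP_preim_pblock aP) rank_preim. Qed.

(** Every block of the product meets X, so [glue f g] takes all its values there, as values of [f],
    and [f] factors through the block map of [a]. The bound for [b] uses X' and [g]. *)
Lemma rank_mul a b : a \in IP X -> b \in IP X ->
  rank (mul a b) <= rank a /\ rank (mul a b) <= rank b.
Proof.
move=> aP bP; have abP := mul_IP aP bP.
have [f [g [fP gP fg ab]]] := mul_IP_pushout aP bP.
have ab_meets u := IP_block_meets abP (pblock_in_IP u abP).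
have glueE u v : pblock (mul a b) u = pblock (mul a b) v -> glue f g u = glue f g v.
  by move/eqP; rewrite -same_blockE // ab same_block_preim => /eqP.
rewrite (rank_imset_pblock aP) (rank_imset_pblock bP) ab rank_preim.
split.
- suff sub : glue f g @: setT \subset f @: setT.
    apply: leq_trans (subset_leq_card sub) _; apply: leq_card_imset_factor => u v auv.
    by apply: fP; rewrite same_blockE // auv.
  apply/subsetP => _ /imsetP[u _ ->]; have [x xu] := (ab_meets u).1.
  by rewrite -(glueE _ _ xu) /= imset_f.
- suff sub : glue f g @: setT \subset g @: setT.
    apply: leq_trans (subset_leq_card sub) _; apply: leq_card_imset_factor => u v buv.
    by apply: gP; rewrite same_blockE // buv.
  apply/subsetP => _ /imsetP[u _ ->]; have [x xu] := (ab_meets u).2.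
  by rewrite -(glueE _ _ xu) /= imset_f.
Qed.

(** * Factorization through an element of at least the same rank *)

Definition relabel (T : Type) (p q : X -> T) u :=
  match u with inl x => p x | inr x => q x end.

(* The pushout of [s \o f] and a surjection [f] is [s]. *)
Lemma mul_relabel_l (T : eqType) (s : {set X + X} -> T) (p : X -> T) b : b \in IP X ->
  mul (preim_partition (relabel p (fun x => s (pblock b (inl x)))) setT) b =
  preim_partition (relabel p (fun x => s (pblock b (inr x)))) setT.
Proof.
move=> bP; set h := relabel _ _; set h' := relabel _ _.
have b_meets u := (IP_block_meets bP (pblock_in_IP u bP)).1.
(* The maps [h] and [s \o pblock b] agree on the middle copy, so they form a cocone. *)
have hE : glue h (s \o pblock b) =1 h' by case.
apply: mul_preim => u v; split.
  rewrite -!hE; apply: mul_rel_glue => // {}u {}v.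
    by rewrite same_block_preim => /eqP.
  by rewrite same_blockE // => /eqP /= ->.
have lr x y : h' (inl x) = h' (inr y) ->
    mul_rel_lr (preim_partition h setT) b x y.
  (* One middle point in the [b]-block of [inr y] suffices, hence a constant chain. *)
  move=> /= pxy; have [z bz] := b_meets (inr y).
  exists 1, (fun=> z); split=> // [|i||]; try lia.
    by rewrite same_block_preim /= bz pxy.
  by rewrite same_blockE // bz.
case: u v => [x|x] [y|y]; [|exact: lr|by move/esym/lr|] => /= hxy.
  by left; rewrite same_block_preim /= hxy.
have [z bz] := b_meets (inr x); have [w bw] := b_meets (inr y).
right; exists 1, (fun i => if i == 1 then z else w).
split=> //= [|i i_1|i|]; try lia.
- by rewrite same_blockE // bz.
- have -> : i = 1 by lia.
  by rewrite same_block_preim /= bz bw hxy.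
- by rewrite same_blockE // bw.
Qed.

Lemma IP_rank_gt0 a x : a \in IP X -> 0 < rank a.
Proof.
by move=> aP; rewrite /rank card_gt0; apply/set0Pn; exists (pblock a (inl x)); apply: pblock_in_IP.
Qed.

Lemma IP_rank_le_card a : a \in IP X -> rank a <= #|X|.
Proof.
move=> aP; rewrite -cardsT; apply: leq_trans (leq_imset_card (pblock a \o inl) _).
apply/subset_leq_card/subsetP => B aB.
by have [[x <-] _] := IP_block_meets aP aB; apply: (imset_f (pblock a \o inl)).
Qed.

(* With [s] mapping the blocks of [b] onto those of [c], left multiplication
   replaces the upper half of [b] by that of [c] and merges its blocks along
   [s]; right multiplication then replaces the lower half. *)
Lemma rank_le_factor b c : b \in IP X -> c \in IP X -> rank c <= rank b ->
  exists d e, [/\ d \in IP X, e \in IP X & c = mul (mul d b) e].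
Proof.
move=> bP cP le_cb.
have [X0|[x0 _]] := set_0Vmem [set: X].
  have no_x (x : X) : False by have := in_setT x; rewrite X0 inE.
  exists c, c; split=> //; rewrite -[LHS](IP_preim_pblock cP).
  by symmetry; apply: mul_preim; case=> x; case: (no_x x).
have c0 : c != set0 by rewrite -card_gt0; apply: (IP_rank_gt0 x0).
have [s sbc] := surjection_of_leq_card c0 le_cb.
have b_meets u := IP_block_meets bP (pblock_in_IP u bP).
have s_onto u : exists B, B \in b /\ s B = pblock c u.
  have := pblock_in_IP u cP; rewrite -[in X in _ \in X -> _]sbc.
  by case/imsetP=> B bB ->; exists B.
have sc u : s (pblock b u) \in c by rewrite -sbc imset_f // pblock_in_IP.
pose top x := pblock c (inl x); pose bot x := pblock c (inr x).
pose stop x := s (pblock b (inl x)); pose sbot x := s (pblock b (inr x)).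
have stopP u : exists x, stop x = pblock c u.
  have [B [bB <-]] := s_onto u; have [[x xB] _] := IP_block_meets bP bB.
  by exists x; rewrite /stop xB.
have sbotP u : exists x, sbot x = pblock c u.
  have [B [bB <-]] := s_onto u; have [_ [x xB]] := IP_block_meets bP bB.
  by exists x; rewrite /sbot xB.
have c_meets u := IP_block_meets cP (sc u).
have dP : preim_partition (relabel top stop) setT \in IP X.
  apply: preim_partition_IP => -[x|x] /=; split; try by exists x.
    exact: stopP.
  by have [] := c_meets (inl x).
have eP : preim_partition (relabel sbot bot) setT \in IP X.
  apply: preim_partition_IP => -[x|x] /=; split; try by exists x.
    by have [] := c_meets (inr x).
  exact: sbotP.
exists (preim_partition (relabel top stop) setT).
exists (preim_partition (relabel sbot bot) setT).
split=> //; rewrite mul_relabel_l //.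
pose e := preim_partition (relabel sbot bot) setT.
(* To multiply by [e] with [mul_relabel_l], the labels [sbot] must be a function of the blocks of
   [e]; [t] reads the label off a block, with an arbitrary default elsewhere. *)
pose t B := if [pick u | pblock e u == B] is Some u then relabel sbot bot u else B.
have tE u : t (pblock e u) = relabel sbot bot u.
  rewrite /t; case: pickP => [v|/(_ u)]; last by rewrite eqxx.
  by rewrite -same_blockE // same_block_preim => /eqP.
have := mul_relabel_l t top eP; rewrite -/e.
have -> : (fun x => t (pblock e (inl x))) = sbot by apply/funext => x; rewrite tE.
have -> : (fun x => t (pblock e (inr x))) = bot by apply/funext => x; rewrite tE.
rewrite -/sbot => ->; rewrite -[LHS](IP_preim_pblock cP).
(* The map [relabel top bot] is the block map of [c]. *)
by congr preim_partition; apply/funext; case.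
Qed.

(** * Principal ideals, arbitrary ideals and the realization of every rank *)

Lemma in_rank_le a k : (a \in rank_le X k) = (a \in IP X) && (rank a <= k).
Proof. by rewrite inE. Qed.

Lemma IP_mul_IP_rank_le b : b \in IP X -> IP_mul_IP b = rank_le X (rank b).
Proof.
move=> bP; apply/setP=> c; rewrite in_rank_le; apply/imset2P/andP.
  case=> d e dP eP ->; have dbP := mul_IP dP bP; split; first exact: mul_IP.
  exact: leq_trans (rank_mul dbP eP).1 (rank_mul dP bP).2.
case=> cP /(rank_le_factor bP cP)[d [e [dP eP ->]]].
by exists d e.
Qed.

Lemma ideal_rank_le (I : {set {set {set X + X}}}) : ideal I ->
  exists2 a, a \in IP X & I = rank_le X (rank a).
Proof.
case=> /set0Pn[a0 Ia0] sIP mulI.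
have [a Ia a_max] := arg_maxnP (fun a => rank a) Ia0.
have aP := subsetP sIP a Ia; exists a => //; apply/setP=> c.
apply/idP/idP => [Ic|]; first by rewrite in_rank_le (subsetP sIP) //=; apply: a_max.
rewrite -IP_mul_IP_rank_le // => /imset2P[d e dP eP ->].
by have [_ /mulI/(_ eP)[]] := mulI _ _ Ia dP.
Qed.

End Blocks.

Lemma exists_IP_rank n k : 0 < k <= n -> exists2 a, a \in IP 'I_n & rank a = k.
Proof.
case: k => // k /= lt_kn.
(* The target rank is now [k.+1]: indices below [k] keep their own label, and all from [k] on share
   the label [k]. *)
pose m (i : 'I_n) : 'I_k.+1 := inord (minn i k).
pose h (u : 'I_n + 'I_n) := match u with inl i => m i | inr i => m i end.
exists (preim_partition h setT).
  by apply: preim_partition_IP => -[i|i] /=; split; exists i.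
rewrite rank_preim -[RHS]card_ord -cardsT; congr #|pred_of_set _|.
apply/setP=> j; rewrite inE; apply/imsetP.
exists (inl (widen_ord lt_kn j)); rewrite ?inE //=.
apply: ord_inj; rewrite /m inordK /=; have := ltn_ord j; lia.
Qed.

Theorem proposition9 (n : nat) (n_gt0 : 1 <= n)
    (I : {set {set {set 'I_n + 'I_n}}}) (idealI : ideal I)
    (k : nat) (k_gt0 : 1 <= k) (k_le_n : k <= n) :
  [/\ forall b, b \in IP 'I_n ->
        (rank_le 'I_n k = IP_mul_IP b <-> rank b = k),
      exists m : nat, [/\ 1 <= m, m <= n & I = rank_le 'I_n m]
    & exists2 a, a \in IP 'I_n & I = IP_mul_IP a].
Proof.
have [a aP Ia] := ideal_rank_le idealI.
split=> [b bP||]; last by exists a; rewrite ?IP_mul_IP_rank_le.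
  rewrite IP_mul_IP_rank_le //; split=> [/setP rank_kb | -> //].
  (* Testing the equality of the two sets on [b] and on an element [c] of rank [k] gives both
     inequalities between [rank b] and [k]. *)
  have [c cP ck] := exists_IP_rank (introT andP (conj k_gt0 k_le_n)).
  have := rank_kb b; have := rank_kb c; rewrite !in_rank_le bP cP ck !leqnn /=; lia.
exists (rank a); split=> //; first exact: IP_rank_gt0 (Ordinal n_gt0) aP.
by rewrite -[n in _ <= n]card_ord; apply: IP_rank_le_card.
Qed.
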